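(* Let $X$ be a nondegenerate hereditarily unicoherent (Hausdorff) continuum. Then the following statements are equivalent: (i) $X$ is a Wilder continuum; (ii) $X$ is a dendroid; (iii) $X$ is a hereditarily Wilder continuum; (iv) $X$ is a continuum-wise Wilder continuum.
   Context: A continuum is a nonempty compact connected Hausdorff space (not assumed metrizable; one-point continua are allowed); nondegenerate means having more than one point. An arc is a continuum with exactly two non-separating points (its end points); a space is arcwise connected if any two distinct points of it are the end points of an arc contained in it. A continuum is hereditarily unicoherent if the intersection of any two of its subcontinua is connected (possibly empty). A dendroid is a nondegenerate hereditarily unicoherent arcwise connected continuum. A space $X$ has the Wilder property if it has at least three points and for any mutually distinct points $x,y,z\in X$ there exists a continuum $K\subset X$ containing $x$ and exactly one of the points $y,z$. A Wilder continuum is a continuum with the Wilder property. A hereditarily Wilder continuum is a continuum each of whose nondegenerate subcontinua has the Wilder property. A space $X$ has the continuum-wise Wilder property if it contains at least three points and for any mutually disjoint subcontinua $A,B,C$ of $X$ there exists a subcontinuum $L\supset A$ of $X$ containing exactly one of $B,C$ and disjoint from the other one (i.e. either $B\subset L$ and $C\cap L=\emptyset$, or $C\subset L$ and $B\cap L=\emptyset$). A continuum-wise Wilder continuum is a continuum with this property. *)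

(* Defs.v *)
From mathcomp Require Import all_boot all_classical topology.
Set Implicit Arguments.
Unset Strict Implicit.
Unset Printing Implicit Defensive.
Local Open Scope classical_set_scope.

(* All notions are stated for a subset A of an ambient topological space T,
   regarded as a space with the subspace topology; a space X itself is the case
   A = [set: X].  [compact] and [connected] on sets are intrinsic to A, and
   [set_type A] carries the subspace topology. *)

Definition nondegenerate_set (T : Type) (A : set T) : Prop :=
  exists x y, [/\ A x, A y & x <> y].

Definition at_least_three (T : Type) (A : set T) : Prop :=
  exists x y z, [/\ A x, A y & A z] /\ [/\ x <> y, y <> z & x <> z].

Definition continuum (T : topologicalType) (A : set T) : Prop :=
  [/\ A !=set0, compact A, connected A & hausdorff_space (set_type A)].

Definition subcontinuum (T : topologicalType) (A K : set T) : Prop :=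
  K `<=` A /\ continuum K.

Definition non_separating_points (T : topologicalType) (A : set T) : set T :=
  [set p | A p /\ connected (A `\ p)].

(* A is an arc whose end points are x and y. *)
Definition arc_between (T : topologicalType) (A : set T) (x y : T) : Prop :=
  [/\ continuum A, x <> y & non_separating_points A = [set x; y]].

Definition arcwise_connected (T : topologicalType) (A : set T) : Prop :=
  forall x y, A x -> A y -> x <> y ->
  exists K : set T, K `<=` A /\ arc_between K x y.

Definition hereditarily_unicoherent (T : topologicalType) (A : set T) : Prop :=
  forall K L : set T, subcontinuum A K -> subcontinuum A L ->
  connected (K `&` L).

Definition dendroid (T : topologicalType) (A : set T) : Prop :=
  [/\ continuum A, nondegenerate_set A, hereditarily_unicoherent A &
      arcwise_connected A].

Definition wilder_property (T : topologicalType) (A : set T) : Prop :=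
  at_least_three A /\
  forall x y z, A x -> A y -> A z -> x <> y -> y <> z -> x <> z ->
  exists K : set T, [/\ subcontinuum A K, K x &
    (K y /\ ~ K z) \/ (K z /\ ~ K y)].

Definition wilder_continuum (T : topologicalType) (A : set T) : Prop :=
  continuum A /\ wilder_property A.

Definition hereditarily_wilder_continuum (T : topologicalType) (A : set T) :
    Prop :=
  continuum A /\
  forall K : set T, subcontinuum A K -> nondegenerate_set K -> wilder_property K.

Definition continuum_wise_wilder_property (T : topologicalType) (X : set T) :
    Prop :=
  at_least_three X /\
  forall A B C : set T,
  subcontinuum X A -> subcontinuum X B -> subcontinuum X C ->
  A `&` B = set0 -> B `&` C = set0 -> A `&` C = set0 ->
  exists L : set T, [/\ subcontinuum X L, A `<=` L &
    (B `<=` L /\ C `&` L = set0) \/ (C `<=` L /\ B `&` L = set0)].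

Definition continuum_wise_wilder_continuum (T : topologicalType) (A : set T) :
    Prop :=
  continuum A /\ continuum_wise_wilder_property A.

(* Main.v *)
Require Import Defs.
From mathcomp Require Import all_boot all_classical topology.
Set Implicit Arguments.
Unset Strict Implicit.
Unset Printing Implicit Defensive.
Local Open Scope classical_set_scope.

(** The proof rests on the span of two points [x] and [y], the intersection of
    all continua containing both. Hereditary unicoherence makes the family of
    these continua directed, so by compactness the span is itself a continuum:
    it is the unique continuum irreducible between [x] and [y].

    The Wilder property says that spans with a common end behave like initial
    segments of a line: if [c] is in the span of [a], [d] and [d] is in the span
    of [a], [c], then [c = d] ([wilder_span_antisym]). Indeed no continuum
    containing [a] then contains just one of [c], [d]. Two of the implications
    follow from this order-like behaviour.
    - From the Wilder property to dendroids: a point [z] of the span of [x], [y]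
      divides it into the spans of [x], [z] and of [z], [y], and antisymmetry
      forces these two pieces to meet only in [z]. So [z] separates the span,
      while the ends do not, and the span is an arc ([wilder_span_arc]).
    - From the Wilder property to its continuum-wise form: given disjoint [A],
      [B], [C], join [A] to [B] by a span. If it runs into [C] on its way, then
      the part of it from [A] to [C] must avoid [B], again by antisymmetry
      ([wilder_continuum_wise_wilder]). Conversely, singletons are continua.

    To go from dendroids to the hereditary Wilder property one needs that an arc
    is irreducible between its ends ([arc_irreducible]). By hereditary
    unicoherence every subcontinuum of a dendroid then contains the arcs joining
    its points, and the arcs from [x] to [y] and from [x] to [z] cannot both
    contain all three points, for they would coincide. Irreducibility itself
    comes from the non-cut point existence theorem [exists_noncut_point], proved
    with Zorn's lemma in the absence of a metric. *)

(** * Subspaces and connectedness *)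

Lemma hausdorff_space_setT (T : topologicalType) :
  hausdorff_space (set_type [set: T]) -> hausdorff_space T.
Proof.
rewrite !open_hausdorff => haus x y xNy.
pose inT (z : T) : set_type [set: T] := exist _ z (mem_set (I : [set: T] z)).
have /haus[[U V]/= [xU yV] [[U' U'o U'E] [V' V'o V'E] UV0]] : inT x != inT y.
  by apply: contra_neq xNy => -[].
exists (U', V') => /=; first split.
- by move: xU; rewrite !inE -U'E.
- by move: yV; rewrite !inE -V'E.
- split=> //; apply/eqP/seteqP; split=> // z [U'z V'z].
  move/eqP/seteqP: UV0 => [+ _] => /(_ (inT z)); apply.
  by rewrite -U'E -V'E.
Qed.

Lemma hausdorff_space_set_type (T : topologicalType) (A : set T) :
  hausdorff_space T -> hausdorff_space (set_type A).
Proof.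
rewrite !open_hausdorff => haus x y xNy.
have /haus[[U V]/= [xU yV] [Uo Vo /eqP UV0]] : set_val x != set_val y.
  by apply: contra_neq xNy; exact: val_inj.
exists (set_val @^-1` U, set_val @^-1` V) => /=.
  by move: xU yV; rewrite !inE.
split; [by exists U|by exists V|].
apply/eqP/seteqP; split=> // z [Uz Vz].
by have : (U `&` V) (set_val z) by []; rewrite UV0.
Qed.

Lemma connected_closed_split (T : topologicalType) (A D E : set T) :
  connected A -> closed D -> closed E -> A `<=` D `|` E ->
  A `&` D `&` E = set0 -> A `<=` D \/ A `<=` E.
Proof.
move=> Ac Dc Ec ADE ADE0.
have [[x [Ax Dx]]|AD0] := pselect (A `&` D !=set0); last first.
  right=> x Ax; have [Dx|//] := ADE x Ax.
  by case: AD0; exists x.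
left; suff <- : A `&` D = A by move=> y [].
apply: Ac; [by exists x| |by exists D].
exists (~` E); first by rewrite openC.
apply/seteqP; split=> y [Ay].
  by move=> Dy; split=> // Ey; have : (A `&` D `&` E) y by []; rewrite ADE0.
by move=> Ey; split=> //; have [] := ADE y Ay.
Qed.

Lemma closed_connected (T : topologicalType) (A : set T) :
  closed A ->
  (forall D E, closed D -> closed E -> A = D `|` E -> D `&` E = set0 ->
    D !=set0 -> ~ (E !=set0)) ->
  connected A.
Proof.
move=> Acl noDE B B0 [O Oo BO] [C Ccl BC].
apply/seteqP; split=> [x|x Ax]; first by rewrite BC => -[].
apply: contrapT => nBx; apply: (noDE B (A `\` O)) => //.
- by rewrite BC; exact: closedI.
- by apply: closedI => //; rewrite closedC.
- apply/seteqP; split=> [y Ay|y [|[]//]]; last by rewrite BC => -[].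
  have [Oy|Oy] := pselect (O y); last by right.
  by left; rewrite BO.
- by apply/seteqP; split=> // y [+ [_]]; rewrite BO => -[].
- by exists x; split=> // Ox; apply: nBx; rewrite BO.
Qed.

(** A separation [D], [E] of [P] with [p] in [D] would give the separation
    [D `|` Q], [E] of the whole union. *)
Lemma connected_closed_part (T : topologicalType) (p : T) (P Q : set T) :
  closed P -> closed Q -> connected (P `|` Q) -> P `&` Q = [set p] ->
  connected P.
Proof.
move=> Pcl Qcl PQc PQp; have [Pp Qp] : (P `&` Q) p by rewrite PQp.
(* By symmetry the common point may be assumed to lie in the first piece. *)
suff noDE D E : closed D -> closed E -> P = D `|` E -> D `&` E = set0 -> D p ->
    ~ (E !=set0).
  apply: closed_connected => // D E Dcl Ecl PDE DE0 D0 E0.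
  have : P p by [].
  rewrite PDE => -[Dp|Ep]; first exact: (noDE D E).
  by apply: (noDE E D) => //; rewrite 1?setUC // setIC.
move=> Dcl Ecl PDE DE0 Dp [e Ee].
have DEn x : D x -> E x -> False.
  by move=> Dx Ex; have : (D `&` E) x by []; rewrite DE0.
have QEn x : Q x -> E x -> False.
  move=> Qx Ex; apply: (DEn x) => //.
  suff -> : x = p by [].
  have : (P `&` Q) x by split=> //; rewrite PDE; right.
  by rewrite PQp.
have : P `|` Q `<=` D `|` Q \/ P `|` Q `<=` E.
  apply: connected_closed_split => //; first exact: closedU.
  - rewrite PDE => x [[Dx|Ex]|Qx]; [by left; left|by right|by left; right].
  - by apply/seteqP; split=> // x [[_ [/DEn|/QEn]]] /[apply].
case=> [sub|/(_ p)]; last by move=> sub; apply: (DEn p) => //; apply: sub; left.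
have PQe : (P `|` Q) e by left; rewrite PDE; right.
by have [/DEn|/QEn] := sub e PQe; apply.
Qed.

(** The points of a two-point Hausdorff space form a separation of it. *)
Lemma connected_at_least_three (T : topologicalType) (A : set T) :
  hausdorff_space T -> connected A -> nondegenerate_set A -> at_least_three A.
Proof.
move=> haus Ac [x [y [Ax Ay xy]]]; apply: contrapT => no3.
have cl1 := accessible_closed_set1 (hausdorff_accessible haus).
have Axy z : A z -> z = x \/ z = y.
  move=> Az; have [->|zx] := pselect (z = x); first by left.
  have [->|zy] := pselect (z = y); first by right.
  by case: no3; exists x, y, z; split=> //; split=> // /esym.
have [/(_ y Ay)|/(_ x Ax)] : A `<=` [set x] \/ A `<=` [set y].
- apply: connected_closed_split => //.
  by apply/seteqP; split=> // z [[_ ->]].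
- by move/esym.
- by [].
Qed.

(** * Cut points *)

(** Both halves are taken closed, hence share the point [p]: each of them is
    then connected whenever [A] is, and can itself be handled as a continuum. *)
Definition cut_at (T : topologicalType) (A : set T) (p : T) (P Q : set T) :=
  [/\ closed P, closed Q, A = P `|` Q, P `&` Q = [set p] &
      ~ (P `<=` [set p]) /\ ~ (Q `<=` [set p])].

Lemma cut_atC (T : topologicalType) (A P Q : set T) (p : T) :
  cut_at A p P Q -> cut_at A p Q P.
Proof.
by case=> Pcl Qcl -> PQ [P1 Q1]; split=> //; rewrite 1?setUC // setIC.
Qed.

Lemma cut_at_disconnected (T : topologicalType) (A P Q : set T) (p : T) :
  cut_at A p P Q -> ~ connected (A `\ p).
Proof.
case=> Pcl Qcl APQ PQp [P1 Q1] Apc.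
have sub : A `\ p `<=` P `|` Q by rewrite APQ => x [].
have PQ0 : (A `\ p) `&` P `&` Q = set0.
  apply/seteqP; split=> // x [[[_ xp] Px] Qx]; apply: xp.
  by rewrite -PQp.
have [ApP|ApQ] := connected_closed_split Apc Pcl Qcl sub PQ0.
- apply: Q1 => x Qx; apply: contrapT => xp; apply: (xp).
  by rewrite -PQp; split=> //; apply: ApP; split=> //; rewrite APQ; right.
- apply: P1 => x Px; apply: contrapT => xp; apply: (xp).
  by rewrite -PQp; split=> //; apply: ApQ; split=> //; rewrite APQ; left.
Qed.

Lemma disconnected_cut_at (T : topologicalType) (A : set T) (p : T) :
  hausdorff_space T -> closed A -> A p -> ~ connected (A `\ p) ->
  exists P Q, cut_at A p P Q.
Proof.
move=> haus Acl Ap Apc.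
have pcl : closed [set p].
  exact: accessible_closed_set1 (hausdorff_accessible haus) p.
apply: contrapT => nocut; apply: Apc => B [b Bb] [O Oo BO] [C Ccl BC].
apply/seteqP; split=> [x|x Apx]; first by rewrite BC => -[].
apply: contrapT => nBx; apply: nocut.
exists ((A `&` C) `|` [set p]), ((A `\` O) `|` [set p]); split.
- by apply: closedU => //; exact: closedI.
- by apply: closedU => //; apply: closedI => //; rewrite closedC.
- apply/seteqP; split=> [y Ay|y [[[]|->]|[[]|->]]//].
  have [->|yp] := pselect (y = p); first by left; right.
  have [Oy|Oy] := pselect (O y); last by right; left.
  have : B y by rewrite BO.
  by rewrite BC => -[_ Cy]; left; left.
- apply/seteqP; split=> [y [[[Ay Cy]|//] [[_ Oy]|//]]|y ->]; last first.
    by split; right.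
  apply: contrapT => yp; apply: Oy.
  suff : B y by rewrite BO => -[].
  by rewrite BC.
- split=> sub.
    move: Bb; rewrite BC => -[[Ab bp] Cb]; apply: bp.
    by apply: sub; left.
  case: (Apx) => Ax xp; apply: xp; apply: sub; left; split=> // Ox.
  by apply: nBx; rewrite BO.
Qed.

Lemma cut_at_connected (T : topologicalType) (A P Q : set T) (p : T) :
  connected A -> cut_at A p P Q -> connected P.
Proof.
by move=> Ac [Pcl Qcl APQ PQp _]; apply: connected_closed_part PQp => //;
  rewrite -APQ.
Qed.

(** Otherwise the closed sets [K `\` O] generate a proper filter; a cluster
    point of it lies in the whole intersection but not in [O]. *)
Lemma compact_bigcap_subset (T : topologicalType)
    (F : set (set T)) (O : set T) :
  compact [set: T] -> F !=set0 -> (forall K, F K -> closed K) ->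
  (forall K L, F K -> F L -> exists2 M, F M & M `<=` K `&` L) ->
  open O -> \bigcap_(K in F) K `<=` O -> exists2 K, F K & K `<=` O.
Proof.
move=> Tco [K0 FK0] Fcl Fdir Oo FO; apply: contrapT => noK.
have KO K : F K -> (K `\` O) !=set0.
  move=> FK; apply: contrapT => KO0; apply: noK; exists K => // x Kx.
  by apply: contrapT => Ox; apply: KO0; exists x.
have PF : ProperFilter (filter_from F (fun K => K `\` O)).
  apply: filter_from_proper => //.
  apply: filter_from_filter; first by exists K0.
  move=> K L FK FL; have [M FM MKL] := Fdir _ _ FK FL.
  by exists M => // x [/MKL[Kx Lx] Ox].
have [x [_ xcl]] := Tco _ PF (filterT).
have xKO K : F K -> (K `\` O) x.
  move=> FK; suff : closed (K `\` O).
    by apply=> B xB; apply: xcl => //; exists K.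
  by apply: closedI; [exact: Fcl|rewrite closedC].
have [_] := xKO _ FK0; apply; apply: FO => K FK.
by have [] := xKO _ FK.
Qed.

(** Suppose that every [q] other than [p] cuts [A], and let [C q] be the half
    that avoids [p]. If [w <> q] lies in [C q], then the half at [q] containing
    [p] is connected and misses [w], so it stays on the side of [p] in the cut
    at [w]; hence [C w] is contained in [C q] without [q]. A minimal [C q],
    given by Zorn's lemma and compactness, would thus be reduced to [q],
    contrary to the definition of a cut. *)
Lemma exists_noncut_point (T : topologicalType) (A : set T) (p : T) :
  compact [set: T] -> hausdorff_space T -> closed A -> connected A ->
  A p -> ~ (A `<=` [set p]) -> exists q, [/\ A q, q <> p & connected (A `\ q)].
Proof.
move=> Tco haus Acl Ac Ap A1; apply: contrapT => noq.
pose S := {q : T | A q /\ q <> p}.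
have /choice[PQ PQcut] : forall q : S, exists PQ : set T * set T,
    cut_at A (sval q) PQ.1 PQ.2 /\ PQ.1 p.
  case=> q [Aq qp] /=.
  have Aqc : ~ connected (A `\ q) by move=> Aqc; apply: noq; exists q.
  have [P [Q PQcut]] := disconnected_cut_at haus Acl Aq Aqc.
  have [_ _ APQ _ _] := PQcut.
  have [Pp|Qp] : (P `|` Q) p by rewrite -APQ.
    by exists (P, Q).
  by exists (Q, P); split=> //=; exact: cut_atC.
pose C (q : S) := (PQ q).2.
have Ccl q : closed (C q) by case: (PQcut q) => -[].
have APC q x : A x = ((PQ q).1 `|` C q) x.
  by case: (PQcut q) => -[_ _ APQ _ _] _; rewrite [in LHS]APQ.
have CA q : C q `<=` A by move=> x Cx; rewrite (APC q); right.
have Cq q : C q (sval q).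
  case: (PQcut q) => -[_ _ _ PQq _] _.
  have : [set sval q] (sval q) by [].
  by rewrite -PQq => -[].
have Cp q : ~ C q p.
  move=> Cqp; case: (PQcut q) => -[_ _ _ PQq _] Pp.
  have : [set sval q] p by rewrite -PQq.
  by move/esym; case: (svalP q).
have Cdec (v w : S) : C v (sval w) -> sval w <> sval v ->
    C w `<=` C v `\ sval v.
  move=> Cvw wv; have [cutv Pvp] := PQcut v; have [cutw Pwp] := PQcut w.
  have Pvc := cut_at_connected Ac cutv.
  case: cutv => [Pvcl Qvcl APQv PQv _]; case: cutw => [Pwcl Qwcl APQw PQw _].
  have nPvw : ~ (PQ v).1 (sval w).
    by move=> Pvw; apply: wv; have : [set sval v] (sval w) by rewrite -PQv.
  have PvCw0 : (PQ v).1 `&` (PQ w).1 `&` (PQ w).2 = set0.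
    rewrite -setIA PQw; apply/seteqP; split=> // x [Pvx xw]; apply: nPvw.
    by rewrite -xw.
  have PvA : (PQ v).1 `<=` (PQ w).1 `|` (PQ w).2.
    by move=> x Pvx; rewrite -(APC w) (APC v); left.
  have [sub|/(_ p Pvp)/Cp//] := connected_closed_split Pvc Pwcl Qwcl PvA PvCw0.
  have nPvC x : C w x -> ~ (PQ v).1 x.
    move=> Cwx Pvx; have : ((PQ v).1 `&` (PQ w).1 `&` (PQ w).2) x.
      by split=> //; split=> //; exact: sub.
    by rewrite PvCw0.
  move=> x Cwx; split.
    by have := CA _ _ Cwx; rewrite (APC v) => -[/(nPvC x Cwx)|].
  move=> xv; apply: (nPvC x Cwx); rewrite xv.
  have : [set sval v] (sval v) by [].
  by rewrite -PQv => -[].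
have Csub (v w : S) : C v (sval w) -> C w `<=` C v.
  move=> Cvw; have [wv|wv] := pselect (sval w = sval v); last first.
    by move=> x /(Cdec _ _ Cvw wv)[].
  suff -> : w = v by [].
  by case: w v wv {Cvw} => [w Sw] [v Sv] /= wv; apply: eq_exist.
(* For this order a greater point has a smaller half. *)
pose R (v w : S) := `[< C v (sval w) >].
have [||||m mmax] := @Zorn S R.
- by move=> v; apply/asboolP.
- by move=> u v w /asboolP uv /asboolP vw; apply/asboolP; exact: (Csub u v).
- move=> v w /asboolP vw /asboolP wv.
  have [|wv'] := pselect (sval w = sval v).
    by case: w v {vw wv} => [w Sw] [v Sv] /= wv; apply: eq_exist.
  by have [_ /(_ erefl)] := Cdec _ _ vw wv' _ wv.
- move=> F Ftot.
  have [[v0 Fv0]|F0] := pselect (F !=set0); last first.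
    have [x Ax xp] : exists2 x, A x & x <> p.
      by apply: contrapT => nox; apply: A1 => x Ax; apply: contrapT => xp;
         apply: nox; exists x.
    by exists (exist _ x (conj Ax xp)) => s Fs; case: F0; exists s.
  have [x Fx] : \bigcap_(v in F) C v !=set0.
    apply: contrapT => noF.
    have [||||| _ [v Fv <-] Cv0] :=
      @compact_bigcap_subset T (C @` F) set0 Tco.
    + by exists (C v0), v0.
    + by move=> _ [v _ <-].
    + move=> _ _ [v Fv <-] [w Fw <-].
      have [/asboolP vw|/asboolP wv] := Ftot v w Fv Fw.
        exists (C w); first by exists w.
        by move=> x Cwx; split=> //; exact: Csub vw _ _.
      exists (C v); first by exists v.
      by move=> x Cvx; split=> //; exact: Csub wv _ _.
    + exact: open0.
    + by move=> x Cx; apply: noF; exists x => v Fv; apply: Cx; exists v.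
    + exact: Cv0 (Cq v).
  have xS : A x /\ x <> p.
    split; first exact: CA (Fx _ Fv0).
    by move=> xp; apply: (Cp v0); rewrite -xp; exact: Fx.
  by exists (exist _ x xS) => v Fv; apply/asboolP; exact: Fx.
have [[_ _ _ _ [_ Q1]] _] := PQcut m; apply: Q1 => x Cmx.
have xS : A x /\ x <> p.
  by split; [exact: CA Cmx|move=> xp; apply: (Cp m); rewrite -xp].
by rewrite -(mmax (exist _ x xS)) //; apply/asboolP.
Qed.

(** * Continua and arcs *)

Lemma continuumP (T : topologicalType) (A : set T) :
  compact [set: T] -> hausdorff_space T ->
  continuum A <-> [/\ A !=set0, closed A & connected A].
Proof.
move=> Tco haus; split=> [[A0 Aco Ac _]|[A0 Acl Ac]]; split=> //.
- exact: compact_closed.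
- exact: subclosed_compact Tco _.
- exact: hausdorff_space_set_type.
Qed.

Lemma continuum_set1 (T : topologicalType) (x : T) :
  hausdorff_space T -> continuum [set x].
Proof.
move=> haus; split; [by exists x|exact: compact_set1|exact: connected1|].
exact: hausdorff_space_set_type.
Qed.

Lemma closed_disjoint_open (T : topologicalType) (D E : set T) :
  normal_space T -> closed D -> closed E -> D `&` E = set0 ->
  exists U V, [/\ open U, open V, D `<=` U, E `<=` V & U `&` V = set0].
Proof.
move=> Tn Dcl Ecl /disjoints_subset DE.
have [|W DW WE] := Tn D Dcl (~` E).
  by move=> x Dx; apply: open_nbhs_nbhs; split; [rewrite openC|exact: DE].
exists W°, (~` closure W); split.
- exact: open_interior.
- by rewrite openC; exact: closed_closure.
- by move=> x Dx; exact: DW.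
- by move=> x Ex /WE.
- apply/disjoints_subset; rewrite setCK => x /interior_subset.
  exact: subset_closure.
Qed.

Lemma continuumU (T : topologicalType) (K L : set T) :
  compact [set: T] -> hausdorff_space T ->
  continuum K -> continuum L -> K `&` L !=set0 -> continuum (K `|` L).
Proof.
move=> Tco haus /(continuumP _ Tco haus)[[x Kx] Kcl Kc].
move=> /(continuumP _ Tco haus)[_ Lcl Lc] KL0; apply/continuumP => //; split.
- by exists x; left.
- exact: closedU.
- exact: connectedU.
Qed.

(** If [p] in [A] were outside [L], then [L], being connected, would lie in one
    half [P] of a cut of [A] at [p]. A non-cut point [q <> p] of the other half
    is a non-cut point of [A], hence one of the ends; but these are in [L]. *)
Lemma arc_irreducible (T : topologicalType) (A L : set T) (x y : T) :
  compact [set: T] -> hausdorff_space T -> arc_between A x y ->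
  closed L -> connected L -> L `<=` A -> L x -> L y -> A `<=` L.
Proof.
move=> Tco haus [Acont xy Aends] Lcl Lc LA Lx Ly p Ap; apply: contrapT => nLp.
have [_ Acl Ac] := (continuumP _ Tco haus).1 Acont.
have Apc : ~ connected (A `\ p).
  move=> Apc; have : non_separating_points A p by [].
  by rewrite Aends => -[] px; apply: nLp; rewrite px.
have [P0 [Q0 cut0]] := disconnected_cut_at haus Acl Ap Apc.
have [P [Q [LP cutPQ]]] : exists P Q, L `<=` P /\ cut_at A p P Q.
  have [P0cl Q0cl APQ PQp _] := cut0.
  have [|||] := connected_closed_split Lc P0cl Q0cl; last 2 first.
  - by exists P0, Q0.
  - by exists Q0, P0; split=> //; exact: cut_atC.
  - by rewrite -APQ.
  - rewrite -setIA PQp; apply/seteqP; split=> // z [Lz zp].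
    by apply: nLp; rewrite -zp.
have Pc := cut_at_connected Ac cutPQ.
have Qc := cut_at_connected Ac (cut_atC cutPQ).
case: cutPQ => Pcl Qcl APQ PQp [_ Q1].
have [Pp Qp] : (P `&` Q) p by rewrite PQp.
have [q [Qq qp Qqc]] := exists_noncut_point Tco haus Qcl Qc Qp Q1.
have PqP z : P z -> Q z -> z = p.
  by move=> Pz Qz; have : (P `&` Q) z by []; rewrite PQp.
have AqE : A `\ q = P `|` (Q `\ q).
  apply/seteqP; split=> [z [+ zq]|z].
    by rewrite APQ => -[Pz|Qz]; [left|right; split].
  rewrite APQ => -[Pz|[Qz zq]]; last by split=> //; right.
  by split; [left|move=> zq; apply: qp; apply: PqP => //; rewrite -zq].
have : non_separating_points A q.
  split; first by rewrite APQ; right.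
  rewrite AqE; apply: connectedU => //.
  by exists p; split=> //; split=> // pq; apply: qp.
by rewrite Aends => -[] qx; apply: qp; apply: PqP => //; rewrite qx; exact: LP.
Qed.

Lemma arc_ends_mem (T : topologicalType) (A : set T) (x y : T) :
  arc_between A x y -> A x /\ A y.
Proof.
move=> [_ _ Aends].
have [Ax _] : non_separating_points A x by rewrite Aends; left.
by have [Ay _] : non_separating_points A y by rewrite Aends; right.
Qed.

Lemma arc_ends_unique (T : topologicalType) (A : set T) (x y z : T) :
  arc_between A x y -> arc_between A x z -> y = z.
Proof.
move=> [_ xy Axy] [_ _ Axz].
have : [set x; y] y by right.
by rewrite -Axy Axz => -[/esym|].
Qed.

(** * The span of two points *)

Definition span (T : topologicalType) (x y : T) : set T :=
  \bigcap_(K in [set K | [/\ continuum K, K x & K y]]) K.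

Lemma span_subset (T : topologicalType) (K : set T) (x y : T) :
  continuum K -> K x -> K y -> span x y `<=` K.
Proof. by move=> Kc Kx Ky z; apply. Qed.

Lemma span_left (T : topologicalType) (x y : T) : span x y x.
Proof. by move=> K []. Qed.

Lemma span_right (T : topologicalType) (x y : T) : span x y y.
Proof. by move=> K []. Qed.

Lemma spanC (T : topologicalType) (x y : T) : span x y = span y x.
Proof. by apply/seteqP; split=> z xyz K [? ? ?]; apply: xyz. Qed.

Lemma span_refl (T : topologicalType) (x y : T) :
  hausdorff_space T -> span x x y -> y = x.
Proof. by move=> haus; apply: (span_subset (continuum_set1 _ haus)). Qed.

Section HereditarilyUnicoherentContinuum.
Context (X : topologicalType) (X_continuum : continuum [set: X]).
Context (X_hu : hereditarily_unicoherent [set: X]).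

Let X_compact : compact [set: X]. Proof. by case: X_continuum. Qed.

Let X_hausdorff : hausdorff_space X.
Proof. by case: X_continuum => _ _ _; exact: hausdorff_space_setT. Qed.

Let X_subcontinuumP (K : set X) : continuum K <-> subcontinuum [set: X] K.
Proof. by split=> [|[]]. Qed.

Let continuum_closed (K : set X) : continuum K -> closed K.
Proof. by case/continuumP. Qed.

Lemma continuumI (K L : set X) :
  continuum K -> continuum L -> K `&` L !=set0 -> continuum (K `&` L).
Proof.
move=> Kc Lc KL0; apply/continuumP => //; split=> //.
  by apply: closedI; exact: continuum_closed.
by apply: X_hu; exact/X_subcontinuumP.
Qed.

(** A separation of the span extends to disjoint open sets [U], [V]; by
    compactness a single continuum of the family lies in their union, and it is
    separated as well. *)
Lemma span_continuum (x y : X) : continuum (span x y).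
Proof.
have spcl : closed (span x y).
  by apply: closed_bigI => K [Kc _ _]; exact: continuum_closed.
apply/continuumP => //; split=> //; first by exists x; exact: span_left.
apply: closed_connected => // D E Dcl Ecl DE DE0 [d Dd] [e Ee].
have [U [V [Uo Vo DU EV UV0]]] :=
  closed_disjoint_open (compact_normal X_hausdorff X_compact) Dcl Ecl DE0.
have [|||||K [Kc Kx Ky] KUV] := @compact_bigcap_subset X
  [set K | [/\ continuum K, K x & K y]] (U `|` V) X_compact.
- by exists [set: X].
- by move=> K [Kc _ _]; exact: continuum_closed.
- move=> K L [Kc Kx Ky] [Lc Lx Ly]; exists (K `&` L) => //.
  by split=> //; apply: continuumI => //; exists x.
- exact: openU.
- by rewrite -/(span x y) DE => z [/DU|/EV]; [left|right].
have spK := span_subset Kc Kx Ky.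
have [_ _ Kconn] := (continuumP K X_compact X_hausdorff).1 Kc.
have UVn z : U z -> V z -> False.
  by move=> Uz Vz; have : (U `&` V) z by []; rewrite UV0.
have : K `<=` ~` V \/ K `<=` ~` U.
  apply: connected_closed_split => //; rewrite ?closedC //.
  - by move=> z /KUV[Uz|Vz]; [left|right] => /UVn; apply.
  - by apply/seteqP; split=> // z [[/KUV[Uz|Vz]]].
case=> [/(_ e)|/(_ d)]; apply.
- by apply: spK; rewrite DE; right.
- exact: EV.
- by apply: spK; rewrite DE; left.
- exact: DU.
Qed.

Lemma span_split (x y z : X) :
  span x y z -> span x y = span x z `|` span z y.
Proof.
move=> xyz; apply/seteqP; split.
  apply: span_subset; [|by left; exact: span_left|by right; exact: span_right].
  apply: continuumU => //; [exact: span_continuum|exact: span_continuum|].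
  by exists z; split; [exact: span_right|exact: span_left].
have xyc := span_continuum x y.
move=> w [|]; apply: span_subset => //; [exact: span_left|exact: span_right].
Qed.

(** * Consequences of the Wilder property *)

(** A continuum through [a] and [c] contains the span of [a], [c], hence [d];
    and conversely: no continuum distinguishes [c] from [d]. *)
Lemma wilder_span_antisym (a c d : X) :
  wilder_property [set: X] -> span a d c -> span a c d -> c = d.
Proof.
move=> [_ W] adc acd; apply: contrapT => cd.
have ac : a <> c.
  move=> ac; apply: cd; rewrite -ac in acd *.
  by rewrite (span_refl X_hausdorff acd).
have ad : a <> d.
  move=> ad; apply: cd; rewrite -ad in adc *.
  by rewrite (span_refl X_hausdorff adc).
have [//|//|//|K [[_ Kc] Ka [[Kc' nKd]|[Kd nKc]]]] := W a c d I I I.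
- by apply: nKd; exact: span_subset acd.
- by apply: nKc; exact: span_subset adc.
Qed.

(** By antisymmetry, a point [w <> z] common to both pieces would give a
    continuum joining [x] to [y] through [w] and missing [z]. *)
Lemma wilder_span_meet (x y z w : X) :
  wilder_property [set: X] -> span x y z -> span x z w -> span z y w -> w = z.
Proof.
move=> W xyz xzw zyw; apply: contrapT => wz.
suff : (span x w `|` span w y) z.
  case=> [xwz|wyz]; apply: wz; first exact: (wilder_span_antisym (a := x)).
  by apply: (wilder_span_antisym (a := y)) => //; rewrite spanC.
apply: xyz; split; [|by left; exact: span_left|by right; exact: span_right].
apply: continuumU => //; [exact: span_continuum|exact: span_continuum|].
by exists w; split; [exact: span_right|exact: span_left].
Qed.

(** The span without [x] is a union of continua through [y]: by antisymmetry
    [x] is not in the span of [z], [y] when [z <> x]. *)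
Lemma wilder_span_end (x y : X) :
  wilder_property [set: X] -> connected (span x y `\ x).
Proof.
move=> W.
have -> : span x y `\ x = \bigcup_(z in span x y `\ x) span z y.
  apply/seteqP; split=> [z|w [z [xyz zx] zyw]].
    by exists z => //; exact: span_left.
  split; first by rewrite (span_split xyz); right.
  move=> wx; apply: zx; apply: (@wilder_span_antisym y _ _ W); rewrite spanC //.
  by rewrite -wx.
apply: bigcup_connected; first by exists y => z _; exact: span_right.
move=> z _; have [//] := span_continuum z y.
Qed.

Lemma wilder_span_arc (x y : X) :
  wilder_property [set: X] -> x <> y -> arc_between (span x y) x y.
Proof.
move=> W xy; split=> //; first exact: span_continuum.
apply/seteqP; split=> [z [xyz zc]|_ [->|->]]; last 2 first.
- by split; [exact: span_left|exact: wilder_span_end].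
- by split; [exact: span_right|rewrite spanC; exact: wilder_span_end].
apply: contrapT => zxy.
apply: (@cut_at_disconnected _ (span x y) (span x z) (span z y) z _ zc).
split.
- exact: continuum_closed (span_continuum _ _).
- exact: continuum_closed (span_continuum _ _).
- exact: span_split.
- apply/seteqP; split=> [w [xzw zyw]|_ ->].
    exact: wilder_span_meet xzw zyw.
  by split; [exact: span_right|exact: span_left].
- split=> sub; apply: zxy; [left|right].
    by rewrite (sub _ (@span_left _ x z)).
  by rewrite (sub _ (@span_right _ z y)).
Qed.

Lemma wilder_dendroid :
  nondegenerate_set [set: X] -> wilder_property [set: X] -> dendroid [set: X].
Proof.
move=> X2 W; split=> // x y _ _ xy.
by exists (span x y); split=> //; exact: wilder_span_arc.
Qed.

(** * The equivalence *)

(** By irreducibility and unicoherence, arcs between points of [K] stay in [K].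
    If neither the arc [A] from [x] to [y] nor the arc [B] from [x] to [z] is
    the required continuum, then each contains the ends of the other, so both
    equal their intersection, and [y = z]. *)
Lemma dendroid_hereditarily_wilder (K : set X) :
  arcwise_connected [set: X] -> continuum K -> nondegenerate_set K ->
  wilder_property K.
Proof.
move=> arcs Kc K2; have [_ _ Kconn _] := Kc; split.
  exact: connected_at_least_three.
have arcK x y : K x -> K y -> x <> y ->
    exists2 A, A `<=` K & arc_between A x y.
  move=> Kx Ky xy; have [A [_ Axy]] := arcs x y I I xy; exists A => //.
  have [Ac _ _] := Axy.
  have [Ax Ay] := arc_ends_mem Axy.
  have AK : continuum (A `&` K) by apply: continuumI => //; exists x.
  suff : A `<=` A `&` K by move=> sub z /sub[].
  apply: arc_irreducible Axy _ _ _ _ _ => //.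
  - exact: continuum_closed.
  - by case: AK.
move=> x y z Kx Ky Kz xy yz xz.
have [A AK Axy] := arcK x y Kx Ky xy; have [B BK Bxz] := arcK x z Kx Kz xz.
have [Ac _ _] := Axy; have [Bc _ _] := Bxz.
have [Ax Ay] := arc_ends_mem Axy.
have [Bx Bz] := arc_ends_mem Bxz.
have [Az|Az] := pselect (A z); last by exists A; split=> //; left.
have [By|By] := pselect (B y); last by exists B; split=> //; right.
have AB : continuum (A `&` B) by apply: continuumI => //; exists x.
have [_ ABcl ABconn] := (continuumP _ X_compact X_hausdorff).1 AB.
case: yz; apply: (@arc_ends_unique _ A x) => //.
suff -> : A = B by [].
apply/seteqP; split.
  suff : A `<=` A `&` B by move=> sub w /sub[].
  by apply: arc_irreducible Axy _ _ _ _ _.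
suff : B `<=` A `&` B by move=> sub w /sub[].
by apply: arc_irreducible Bxz _ _ _ _ _.
Qed.

(** If the span of [a], [b] meets [C] in [c], the span of [a], [c] misses [B]:
    a common point [d] would split the span of [a], [b], with [c] in one of the
    parts. It is not in the span of [d], [b], which lies in [B]; so it is in the
    span of [a], [d], and antisymmetry gives [c = d]. *)
Lemma wilder_continuum_wise_wilder :
  wilder_property [set: X] -> continuum_wise_wilder_property [set: X].
Proof.
move=> W; split; first by case: W.
move=> A B C [_ Ac] [_ Bc] [_ Cc] AB0 BC0 AC0.
have joinP K L x y : continuum K -> continuum L -> K x -> L y ->
    subcontinuum [set: X] (K `|` span x y `|` L).
  move=> Kc Lc Kx Ly; apply/X_subcontinuumP; apply: continuumU => //.
    apply: continuumU => //; first exact: span_continuum.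
    by exists x; split=> //; exact: span_left.
  by exists y; split=> //; right; exact: span_right.
have [[a Aa] _ _ _] := Ac; have [[b Bb] _ _ _] := Bc.
have BCn w : B w -> C w -> False.
  by move=> Bw Cw; have : (B `&` C) w by []; rewrite BC0.
have disjoint_join K L M x y : K `&` M = set0 -> L `&` M = set0 ->
    ~ (M `&` span x y !=set0) -> M `&` (K `|` span x y `|` L) = set0.
  move=> KM0 LM0 Mxy; apply/seteqP; split=> // w [Mw [[Kw|xyw]|Lw]].
  - by rewrite -KM0.
  - by case: Mxy; exists w.
  - by rewrite -LM0.
have [[c [Cc' abc]]|Cab] := pselect (C `&` span a b !=set0); last first.
  exists (A `|` span a b `|` B); split; [exact: joinP|by move=> w; left; left|].
  by left; split; [move=> w; right|exact: disjoint_join].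
exists (A `|` span a c `|` C); split; [exact: joinP|by move=> w; left; left|].
right; split; first by move=> w; right.
apply: disjoint_join => //; first by rewrite setIC.
case=> d [Bd acd].
have : (span a d `|` span d b) c.
  by rewrite -span_split // (span_split abc); left.
case=> [adc|dbc]; last by apply: (BCn c) => //; exact: span_subset dbc.
by apply: (BCn c) => //; rewrite (wilder_span_antisym W adc acd).
Qed.

Lemma continuum_wise_wilder_wilder :
  continuum_wise_wilder_property [set: X] -> wilder_property [set: X].
Proof.
case=> X3 cW; split=> // x y z _ _ _ xy yz xz.
have pt u : subcontinuum [set: X] [set u].
  by apply/X_subcontinuumP; exact: continuum_set1.
have pt0 (u v : X) : u <> v -> [set u] `&` [set v] = set0.
  by move=> uv; apply/seteqP; split=> // w [->].
have [L [Lc xL yzL]] := cW _ _ _ (pt x) (pt y) (pt z) (pt0 _ _ xy) (pt0 _ _ yz)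
  (pt0 _ _ xz).
have out (u : X) : [set u] `&` L = set0 -> ~ L u.
  by move=> uL0 Lu; have : ([set u] `&` L) u by []; rewrite uL0.
exists L; split=> //; first exact: xL.
by case: yzL => -[uL /out nL]; [left|right]; split=> //; exact: uL.
Qed.

End HereditarilyUnicoherentContinuum.

Theorem proposition1p4 (X : topologicalType)
  (X_continuum : continuum [set: X])
  (X_nondegenerate : nondegenerate_set [set: X])
  (X_hu : hereditarily_unicoherent [set: X]) :
  [<-> wilder_continuum [set: X];
       dendroid [set: X];
       hereditarily_wilder_continuum [set: X];
       continuum_wise_wilder_continuum [set: X]].
Proof.
tfae.
- by move=> [_ W]; exact: wilder_dendroid.
- move=> [_ _ _ arcs]; split=> // K [_ Kc] K2.
  exact: dendroid_hereditarily_wilder.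
- move=> [_ hW]; split=> //; apply: wilder_continuum_wise_wilder => //.
  exact: hW.
- by move=> [_ cW]; split=> //; exact: continuum_wise_wilder_wilder.
Qed.
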